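(* Let the contact points of the object form a square (regular $n$-gon with $n=4$), with parameters $\rho>0$ and $0<\gamma<1$. If all the vertices of the square move towards the support plane $\mathcal P$ initially, and the dominant eigenvalue of the map $\vec U_0\vec P_{\pi/2}$ is positive and real, then the square undergoes complete chatter (CC).
   Context: Model (linearized kinematics, no friction, no gravity or other external forces). A rigid body of mass $m$ has four potential contact points (vertices) forming a square, with local coordinates $(x_i,y_i,z_* )$, $(x_0,y_0)=(1,0)$, $(x_1,y_1)=(0,1)$, $(x_2,y_2)=(-1,0)$, $(x_3,y_3)=(0,-1)$, the centre of mass being the local origin; its principal radii of gyration satisfy $\rho_x=\rho_y=\rho$. It moves above a fixed plane $\mathcal P$. Generalized coordinates are $\vec q=(\phi_x,\phi_y,h)^T\in\mathbb R^3$ (small rotations and normal displacement of the centre of mass), generalized velocities are $\vec p=\dot{\vec q}=(\omega_x,\omega_y,v)^T\in\mathbb V=\mathbb R^3$. With $\vec f_i=(y_i,-x_i,1)^T$, the distance of vertex $i$ from $\mathcal P$ is $h_i=\vec f_i^T\vec q$ and its normal velocity is $v_i=\vec f_i^T\vec p$; admissible configurations have all $h_i\ge0$. ''Vertex $i$ moves towards $\mathcal P$'' means $v_i<0$. Between impacts $\vec p$ is constant. An impact occurs at vertex $i$ when $h_i=0$ and $v_i<0$; then $\vec q$ is unchanged and $\vec p$ is replaced by $\vec U_i\vec p$, where $$\vec U_i=\vec I-\frac{1+\gamma}{\vec f_i^T\vec\Theta^{-1}\vec f_i}\vec\Theta^{-1}\vec f_i\vec f_i^T,\qquad\vec\Theta=m\,\mathrm{diag}(\rho^2,\rho^2,1),$$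 and $\gamma\in(0,1)$ is the coefficient of restitution. In particular $$\vec U_0=\begin{bmatrix}1&0&0\\0&1-\frac{\gamma+1}{\rho^2+1}&\frac{\gamma+1}{\rho^2+1}\\0&\frac{\rho^2(\gamma+1)}{\rho^2+1}&\frac{\gamma+1}{\rho^2+1}-\gamma\end{bmatrix},\qquad \vec P_{\alpha}=\begin{bmatrix}\cos\alpha&-\sin\alpha&0\\\sin\alpha&\cos\alpha&0\\0&0&1\end{bmatrix}.$$ Impacts occur at single vertices (simultaneous impacts are not modelled). Complete chatter (CC): the object undergoes an infinite sequence of collisions in finite time, after which its velocity relative to the surface becomes zero. A dominant eigenvalue of a matrix is an eigenvalue of maximal modulus; the hypothesis means that $\vec U_0\vec P_{\pi/2}$ has a unique dominant eigenvalue, and that it is real and positive. *)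

(* Defs.v *)
From HB Require Import structures.
From mathcomp Require Import all_boot all_order all_algebra.
From mathcomp Require Import complex.
From mathcomp Require Import all_classical all_reals all_analysis.
Import Order.TTheory GRing.Theory Num.Theory.
Import numFieldNormedType.Exports.

Set Implicit Arguments.
Unset Strict Implicit.
Unset Printing Implicit Defensive.

Local Open Scope classical_set_scope.
Local Open Scope ring_scope.

Section Square.
Variable R : realType.

Definition vertex_x (i : 'I_4) : R := nth 0 [:: 1; 0; -1; 0] i.
Definition vertex_y (i : 'I_4) : R := nth 0 [:: 0; 1; 0; -1] i.

(* Generalized coordinates and velocities are columns, in the order
   (phi_x, phi_y, h) and (omega_x, omega_y, v). *)
Definition contact_vec (i : 'I_4) : 'cV[R]_3 :=
  \col_k nth 0 [:: vertex_y i; - vertex_x i; 1] k.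

(* Applied to a configuration q this is the distance h_i from the plane;
   applied to a velocity p it is the normal velocity v_i. *)
Definition normal (i : 'I_4) (u : 'cV[R]_3) : R :=
  ((contact_vec i)^T *m u) 0 0.

Definition inertia (m rho : R) : 'M[R]_3 :=
  m *: diag_mx (\row_k nth 0 [:: rho ^+ 2; rho ^+ 2; 1] k).

Definition impact_mx (m rho gamma : R) (i : 'I_4) : 'M[R]_3 :=
  let f := contact_vec i in
  let W := invmx (inertia m rho) in
  1%:M - ((1 + gamma) / (f^T *m W *m f) 0 0) *: (W *m f *m f^T).

Definition rot_mx (alpha : R) : 'M[R]_3 :=
  \matrix_(i, j) nth 0 (nth [::]
    [:: [:: cos alpha; - sin alpha; 0];
        [:: sin alpha;   cos alpha; 0];
        [:: 0;           0;         1]] i) j.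

(* Uniqueness is uniqueness of the value z; no condition is put on its
   multiplicity. *)
Definition unique_dominant_eigenvalue n (A : 'M[R[i]]_n) (z : R[i]) : Prop :=
  eigenvalue A z /\ forall w, eigenvalue A w -> w != z -> `|w| < `|z|.

(* A real matrix is viewed over R[i], so that all complex eigenvalues compete. *)
Definition dominant_eigenvalue_real_positive n (A : 'M[R]_n) : Prop :=
  exists2 lam : R, 0 < lam &
    unique_dominant_eigenvalue (map_mx (real_complex R) A) (real_complex R lam).

Definition admissible (q : 'cV[R]_3) : Prop := forall i, 0 <= normal i q.

Definition impacting (i : 'I_4) (q p : 'cV[R]_3) : Prop :=
  normal i q = 0 /\ normal i p < 0.

(* No impact can occur strictly before the end of such a flight: a vertex on
   the plane that moves towards it would penetrate the plane immediately. *)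
Definition free_flight (q p : 'cV[R]_3) (tau : R) : Prop :=
  0 <= tau /\ forall s, 0 <= s <= tau -> admissible (q + s *: p).

(* From (q, p) the next event takes place after time tau, and it is an impact
   at the single vertex i; tau and i are uniquely determined by (q, p). *)
Definition next_impact (q p : 'cV[R]_3) (i : 'I_4) (tau : R) : Prop :=
  [/\ free_flight q p tau,
      impacting i (q + tau *: p) p &
      forall j, impacting j (q + tau *: p) p -> j = i].

Definition next_impact_simultaneous (q p : 'cV[R]_3) : Prop :=
  exists tau i j, [/\ free_flight q p tau, i != j,
    impacting i (q + tau *: p) p & impacting j (q + tau *: p) p].

(* States of the motion started at (q0, p0): the initial state and the states
   immediately after each impact. *)
Inductive reachable (m rho gamma : R) (q0 p0 : 'cV[R]_3) :
    'cV[R]_3 -> 'cV[R]_3 -> Prop :=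
| reachable_init : reachable m rho gamma q0 p0 q0 p0
| reachable_impact q p i tau :
    reachable m rho gamma q0 p0 q p -> next_impact q p i tau ->
    reachable m rho gamma q0 p0 (q + tau *: p) (impact_mx m rho gamma i *m p).

(* The single-impact model describes the whole motion from (q0, p0). *)
Definition no_simultaneous_impacts (m rho gamma : R) (q0 p0 : 'cV[R]_3) : Prop :=
  forall q p, reachable m rho gamma q0 p0 q p -> ~ next_impact_simultaneous q p.

(* t k, q k, p k are the time and state right after the k-th impact (k = 0 is
   the start of the motion); hit k is the vertex hit at time t k.+1. *)
Definition infinite_impact_sequence (m rho gamma : R) (q0 p0 : 'cV[R]_3)
    (hit : nat -> 'I_4) (t : nat -> R) (q p : nat -> 'cV[R]_3) : Prop :=
  [/\ t 0%N = 0, q 0%N = q0, p 0%N = p0 &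
      forall k : nat,
        [/\ next_impact (q k) (p k) (hit k) (t k.+1 - t k),
            q k.+1 = q k + (t k.+1 - t k) *: p k &
            p k.+1 = impact_mx m rho gamma (hit k) *m p k]].

(* The motion is deterministic, so the sequence below is the motion itself. *)
Definition complete_chatter (m rho gamma : R) (q0 p0 : 'cV[R]_3) : Prop :=
  exists hit t q p,
    [/\ infinite_impact_sequence m rho gamma q0 p0 hit t q p,
        exists T : R, t k @[k --> \oo] --> T &
        p k @[k --> \oo] --> (0 : 'cV[R]_3)].

End Square.

(* Main.v *)
(* Let n_i be the normal velocity of vertex i (indices modulo 4) and c the
   coupling of neighbouring vertices. A left eigenvector of U_0 P_{pi/2} shows
   that a positive real eigenvalue lam satisfies
   c lam (1 + lam) = (1 - lam) (lam^2 - gamma), hence lam < 1. Expressed in the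
   n_i, that eigenvector is
   l_i = (1 - lam) n_i + lam^2 n_{i+1} + lam n_{i-1}, which is multiplied by lam
   when the next impact is at i + 1. With its mirror image it cuts out a cone
   of velocities after an impact at i which impacts map into one another; for
   an impact at i + 2 this uses that vertices i + 1 and i - 1 were not hit
   first. As l_i has positive coefficients, some vertex keeps moving down and
   the impacts never stop. The configuration extrapolated to a fixed late time
   T is transformed by impacts in the same way as the velocity and stays in the
   same cones, so no flight lasts until T. Finally the velocity of the centre
   of mass is negative and increases at impacts, and two consecutive impacts
   always increase it by a fixed proportion of what remains, so it tends to 0;
   on the cones it dominates the whole velocity. *)
Require Import Defs.
From mathcomp Require Import all_boot all_order all_algebra.
From mathcomp Require Import all_classical all_reals all_analysis.
From mathcomp Require Import ring lra complex.
Import Order.TTheory GRing.Theory Num.Theory.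
Import numFieldNormedType.Exports.
Set Implicit Arguments.
Unset Strict Implicit.

Local Open Scope ring_scope.

(** * Vertex indices modulo 4 *)

Lemma vertex_cases (i j : 'I_4) : [\/ j = i, j = i + 1, j = i + 2 | j = i + 3].
Proof.
case: i => [[|[|[|[|//]]]] hi]; case: j => [[|[|[|[|//]]]] hj];
  by [apply: Or41; apply: val_inj | apply: Or42; apply: val_inj
     |apply: Or43; apply: val_inj | apply: Or44; apply: val_inj].
Qed.

(** Packed as a product of equations so that one [rewrite] reduces every repeated turn; i - 1 is
    written [i + 3]. *)
Lemma vertex_turn (i : 'I_4) :
  ((i + 1 + 1 = i + 2)%R * (i + 1 + 2 = i + 3)%R * (i + 1 + 3 = i)%R *
   (i + 2 + 1 = i + 3)%R * (i + 2 + 2 = i)%R * (i + 2 + 3 = i + 1)%R *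
   (i + 3 + 1 = i)%R * (i + 3 + 2 = i + 1)%R * (i + 3 + 3 = i + 2)%R)%type.
Proof. by case: i => [[|[|[|[|//]]]] hi]; do !split; apply: val_inj. Qed.

(** * Normal components, the impact matrix and its eigenvalue equation *)

Section Kinematics.
Context {R : realType}.
Implicit Types (i j : 'I_4) (u q p : 'cV[R]_3).

Definition heave u : R := u ord_max 0.

Lemma normal_coord i u :
  normal i u = vertex_y R i * u 0 0 - vertex_x R i * u 1 0 + heave u.
Proof.
rewrite /normal !mxE !big_ord_recl big_ord0 !mxE /= addr0 mul1r mulNr addrA.
by congr (_ * u _ 0 - _ * u _ 0 + u _ 0); apply: val_inj.
Qed.

Lemma normalD i u w : normal i (u + w) = normal i u + normal i w.
Proof. by rewrite /normal mulmxDr mxE. Qed.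

Lemma normalZ i (s : R) u : normal i (s *: u) = s * normal i u.
Proof. by rewrite /normal -scalemxAr mxE. Qed.

Lemma normal_opposite i u : normal i u + normal (i + 2) u = 2 * heave u.
Proof.
rewrite !normal_coord /vertex_x /vertex_y.
by case: i => [[|[|[|[|//]]]] hi] /=; lra.
Qed.

(* Gain in normal velocity of either neighbouring vertex, per unit of impact
   speed. *)
Definition coupling (rho gamma : R) : R :=
  (1 + gamma) * (rho ^+ 2 / (1 + rho ^+ 2)).

(** The mass cancels in (1 + gamma) Theta^-1 f_i / (f_i^T Theta^-1 f_i), which leaves this
    column. *)
Definition impact_dir (rho gamma : R) i : 'cV[R]_3 :=
  ((1 + gamma) / (1 + rho ^+ 2)) *:
    \col_k nth 0 [:: vertex_y R i; - vertex_x R i; rho ^+ 2] k.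

Lemma vertex_norm i : vertex_x R i ^+ 2 + vertex_y R i ^+ 2 = 1.
Proof.
by case: i => [[|[|[|[|//]]]] hi]; rewrite /vertex_x /vertex_y /=; ring.
Qed.

Lemma invmx_inertia_contact (m rho : R) i : 0 < m -> 0 < rho ->
  invmx (inertia m rho) *m contact_vec R i =
    (m * rho ^+ 2)^-1 *:
      \col_k nth 0 [:: vertex_y R i; - vertex_x R i; rho ^+ 2] k.
Proof.
move=> m0 r0.
have mn0 : m != 0 by rewrite gt_eqF.
have rn0 : rho != 0 by rewrite gt_eqF.
have uI : inertia m rho \in unitmx.
  rewrite unitmxE /inertia detZ det_diag !big_ord_recl big_ord0 !mxE /=.
  by rewrite unitfE !mulf_neq0 ?expf_neq0 ?oner_neq0.
apply: (can_inj (mulKmx uI)); rewrite mulKVmx //.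
rewrite -scalemxAr /inertia -scalemxAl mul_diag_mx.
apply/matrixP => k l; rewrite !mxE.
by case: k => [[|[|[|//]]] hk] /=; field; rewrite ?mn0 ?rn0.
Qed.

Lemma impact_mxE (m rho gamma : R) i : 0 < m -> 0 < rho ->
  impact_mx m rho gamma i =
    1%:M - impact_dir rho gamma i *m (contact_vec R i)^T.
Proof.
move=> m0 r0.
have mn0 : m != 0 by rewrite gt_eqF.
have rn0 : rho != 0 by rewrite gt_eqF.
have rp : 1 + rho ^+ 2 != 0 by rewrite gt_eqF // ltr_pwDl // sqr_ge0.
have fWf : ((contact_vec R i)^T *m (invmx (inertia m rho) *m contact_vec R i)) 0 0
    = (1 + rho ^+ 2) / (m * rho ^+ 2).
  rewrite invmx_inertia_contact // -scalemxAr !mxE !big_ord_recl big_ord0 !mxE /=.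
  by rewrite -[X in (X + _) / _](vertex_norm i); field; rewrite mn0 rn0.
rewrite /impact_mx -mulmxA fWf invmx_inertia_contact // -scalemxAl scalerA.
rewrite /impact_dir -scalemxAl; congr (_ - _ *: _).
by field; rewrite mn0 rn0 rp.
Qed.

Lemma normal_impact (m rho gamma : R) i j u : 0 < m -> 0 < rho ->
  normal j (impact_mx m rho gamma i *m u) = normal j u -
    (1 + gamma) / (1 + rho ^+ 2) *
    (vertex_x R i * vertex_x R j + vertex_y R i * vertex_y R j + rho ^+ 2) *
    normal i u.
Proof.
move=> m0 r0; rewrite impact_mxE // mulmxBl mul1mx.
have -> (w : 'cV[R]_3) : normal j (u - w) = normal j u - normal j w.
  by rewrite normalD -scaleN1r normalZ mulN1r.
congr (_ - _); rewrite -mulmxA [(_ ^T *m u)]mx11_scalar -/(normal i u).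
rewrite mul_mx_scalar normalZ mulrC; congr (_ * _).
rewrite normalZ; congr (_ * _).
by rewrite normal_coord /heave !mxE /=; ring.
Qed.

(** [eigenvalue] refers to row vectors. In a left eigenvector (x, y, z) the first two equations make
    x and y multiples of z, and the third becomes the cubic after division by z. *)
Lemma eigenvalue_cubic (m rho gamma lam : R) : 0 < m -> 0 < rho ->
  eigenvalue (impact_mx m rho gamma ord0 *m rot_mx (pi / 2)) lam ->
  coupling rho gamma * lam * (1 + lam) =
    (1 - lam) * (lam ^+ 2 - gamma).
Proof.
move=> m0 r0 /eigenvalueP[v + vn0].
have rp : 1 + rho ^+ 2 != 0 by rewrite gt_eqF // ltr_pwDl // sqr_ge0.
rewrite impact_mxE // mulmxA mulmxBr mulmx1 mulmxA.
set s := v *m impact_dir rho gamma ord0.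
rewrite [s]mx11_scalar mul_scalar_mx => /matrixP E.
have := E 0 0; have := E 0 1; have := E 0 ord_max.
rewrite !mxE !big_ord_recl !big_ord0 !mxE /= cos_pihalf sin_pihalf.
rewrite /vertex_x /vertex_y /=.
have e1 : (lift ord0 ord0 : 'I_3) = 1 by apply: val_inj.
have e2 : (lift ord0 (lift ord0 ord0) : 'I_3) = ord_max by apply: val_inj.
rewrite e1 e2 -[ord0]/(0 : 'I_3).
have [x hx] : exists x, v 0 0 = x by exists (v 0 0).
have [y hy] : exists y, v 0 1 = y by exists (v 0 1).
have [z hz] : exists z, v 0 ord_max = z by exists (v 0 ord_max).
rewrite hx hy hz.
set B := (1 + gamma) / (1 + rho ^+ 2).
have -> : coupling rho gamma = 1 + gamma - B by rewrite /coupling /B; field.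
have Br : B * rho ^+ 2 = 1 + gamma - B by rewrite /B; field.
rewrite Br => E2 E1 E0.
have ex : x = - (lam * y) by lra.
have eyz : (1 + lam ^+ 2) * y = - (1 - lam) * z by move: E0 E2; rewrite ex; nra.
have zn0 : z != 0.
  apply: contraNneq vn0 => z0; have y0 : y = 0.
    move: eyz; rewrite z0 mulr0 => /eqP; rewrite mulf_eq0 => /orP[|/eqP//].
    by rewrite gt_eqF // ltr_pwDl // sqr_ge0.
  apply/eqP/rowP => k; rewrite mxE.
  case: (k =P 0) => [->|k0]; first by rewrite hx ex y0 mulr0 oppr0.
  case: (k =P 1) => [->|k1]; first by rewrite hy y0.
  suff -> : k = ord_max by rewrite hz z0.
  by apply: val_inj; case: k k0 k1 => [[|[|[|//]]] hk] // k0 k1;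
    [case: k0|case: k1]; apply: val_inj.
apply: (mulIf zn0).
have -> : (1 + gamma - B) * lam * (1 + lam) * z
  = (1 + lam ^+ 2) * (1 + gamma - B) * z - (1 - lam) * (1 + gamma - B) * z by ring.
have -> : (1 + lam ^+ 2) * (1 + gamma - B) * z
  = (1 + lam ^+ 2) * ((1 - lam) * z) + B * ((1 + lam ^+ 2) * y).
  have -> : (1 - lam) * z = - (B * y) + (1 + gamma - B) * z by lra.
  by ring.
by rewrite eyz; ring.
Qed.

End Kinematics.

(** * Effect of one impact on the normal components *)

Section Cone.
Context {R : realType} (m rho gamma lam : R).
Hypotheses (m0 : 0 < m) (rho0 : 0 < rho) (gamma0 : 0 < gamma).
Implicit Types (i j : 'I_4) (u q p : 'cV[R]_3).

Local Notation c := (coupling rho gamma).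
Local Notation U := (impact_mx m rho gamma).

Lemma coupling_gt0 : 0 < c.
Proof. by rewrite /coupling !(mulr_gt0, invr_gt0, addr_gt0, exprn_gt0). Qed.

Lemma rho2p1_neq0 : 1 + rho ^+ 2 != 0.
Proof. by rewrite gt_eqF // ltr_pwDl // sqr_ge0. Qed.

Lemma normal_impact_self i u : normal i (U i *m u) = - gamma * normal i u.
Proof.
have := rho2p1_neq0; rewrite normal_impact // -!expr2 vertex_norm => h.
by field.
Qed.

Lemma normal_impact_next i u :
  normal (i + 1) (U i *m u) = normal (i + 1) u - c * normal i u.
Proof.
have := rho2p1_neq0; rewrite normal_impact // /coupling /vertex_x /vertex_y => h.
by case: i => [[|[|[|[|//]]]] hi] /=; field.
Qed.

Lemma normal_impact_prev i u :
  normal (i + 3) (U i *m u) = normal (i + 3) u - c * normal i u.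
Proof.
have := rho2p1_neq0; rewrite normal_impact // /coupling /vertex_x /vertex_y => h.
by case: i => [[|[|[|[|//]]]] hi] /=; field.
Qed.

(** Heave is the mean of the two neighbours of [i], and each of them changes by
    [- c * normal i u]. *)
Lemma heave_impact i u : heave (U i *m u) = heave u - c * normal i u.
Proof.
have := normal_opposite (i + 1) (U i *m u); have := normal_opposite (i + 1) u.
rewrite !vertex_turn normal_impact_next normal_impact_prev; lra.
Qed.

Lemma normal_sides i u :
  normal i u + normal (i + 2) u = normal (i + 1) u + normal (i + 3) u.
Proof.
by rewrite normal_opposite -(normal_opposite (i + 1)) !vertex_turn.
Qed.

Lemma impact_fixed i u : normal i u = 0 -> U i *m u = u.
Proof.
move=> n0; rewrite impact_mxE // mulmxBl mul1mx -mulmxA.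
by rewrite [(_ ^T *m u)]mx11_scalar -/(normal i u) n0 mul_mx_scalar scale0r subr0.
Qed.

(** * The cones and their invariance under impacts *)

Definition descent_form (x y z : R) : R := (1 - lam) * x + lam ^+ 2 * y + lam * z.

(** The two forms are the eigenvector form l_i and its mirror image, since the next impact may turn
    either way. *)
Definition descent_cone i u : Prop :=
  [/\ 0 < normal i u,
      descent_form (normal i u) (normal (i + 1) u) (normal (i + 3) u) < 0 &
      descent_form (normal i u) (normal (i + 3) u) (normal (i + 1) u) < 0].

Hypotheses (lam0 : 0 < lam)
  (lamE : c * lam * (1 + lam) = (1 - lam) * (lam ^+ 2 - gamma)).
Hypothesis (gamma1 : gamma < 1).

(** For lam >= 1 the right side of [lamE] would be nonpositive, as lam^2 >= 1 > gamma, but the left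
    side is positive. *)
Lemma lam_lt1 : lam < 1.
Proof.
have cl : 0 < (1 - lam) * (lam ^+ 2 - gamma).
  by rewrite -lamE mulr_gt0 ?addr_gt0 // mulr_gt0 // coupling_gt0.
rewrite ltNge; apply/negP => l1; move: cl; rewrite ltNge => /negP; apply.
have l2 : 1 <= lam ^+ 2 by rewrite exprn_ege1.
by rewrite mulr_le0_ge0 ?subr_le0 // subr_ge0 (le_trans (ltW gamma1)).
Qed.

(** Pulls the form back through an impact at [i]. By [lamE], gamma (1 - lam) + c lam (1 + lam) =
    lam^2 (1 - lam), so only lam remains in the preimage. *)
Lemma descent_form_impact i u (a b : R) :
  lam * a + b + lam * (1 - lam) * - normal i u
  = (descent_form (- gamma * normal i u) (a - c * normal i u) (b - c * normal i u)) / lam.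
Proof.
have ln0 : lam != 0 by rewrite gt_eqF.
rewrite /descent_form.
have -> : (1 - lam) * (- gamma * normal i u) + lam ^+ 2 * (a - c * normal i u)
  + lam * (b - c * normal i u) = lam ^+ 2 * a + lam * b -
    (gamma * (1 - lam) + c * lam * (1 + lam)) * normal i u by ring.
by rewrite lamE; field.
Qed.

Lemma descent_cone_impact i u : normal i u < 0 ->
  lam * normal (i + 1) u + normal (i + 3) u < lam * (1 - lam) * normal i u ->
  lam * normal (i + 3) u + normal (i + 1) u < lam * (1 - lam) * normal i u ->
  descent_cone i (U i *m u).
Proof.
move=> n0 h1 h3.
rewrite /descent_cone normal_impact_self normal_impact_next normal_impact_prev.
have := descent_form_impact i u (normal (i + 1) u) (normal (i + 3) u).
have := descent_form_impact i u (normal (i + 3) u) (normal (i + 1) u).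
move=> e3 e1; split; first by rewrite mulNr oppr_gt0 pmulr_rlt0.
- rewrite -(pmulr_llt0 _ (_ : 0 < lam^-1)) ?invr_gt0 // -e1; lra.
- rewrite -(pmulr_llt0 _ (_ : 0 < lam^-1)) ?invr_gt0 // -e3; lra.
Qed.

(** The neighbours of [i] sum to n_i + n_{i+2} < n_i; scale by lam and use lam < 1 with all signs
    negative. *)
Lemma descent_cone_first i u : (forall j, normal j u < 0) ->
  descent_cone i (U i *m u).
Proof.
move=> h; have l1 := lam_lt1; have := normal_sides i u.
have := h i; have := h (i + 1); have := h (i + 2); have := h (i + 3).
move=> h3 h2 h1 h0 s.
have a1 : lam * (normal (i + 1) u + normal (i + 3) u) < lam * normal i u.
  by rewrite ltr_pM2l //; lra.
have a2 : (1 - lam) * normal (i + 1) u < 0 by rewrite pmulr_rlt0 // subr_gt0.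
have a3 : (1 - lam) * normal (i + 3) u < 0 by rewrite pmulr_rlt0 // subr_gt0.
have a4 : lam * lam * normal i u < 0 by rewrite pmulr_rlt0 // mulr_gt0.
by apply: descent_cone_impact => //; lra.
Qed.

Lemma descent_cone_step i j u : descent_cone i u -> normal j u < 0 ->
  (j = i + 2 ->
     normal (i + 1) u <= normal i u /\ normal (i + 3) u <= normal i u) ->
  descent_cone j (U j *m u).
Proof.
move=> [h0 h1 h3] nj hop; have l1 := lam_lt1; have s := normal_sides i u.
have e2 : normal (i + 2) u = normal (i + 1) u + normal (i + 3) u - normal i u by lra.
have ol : 0 < 1 - lam by rewrite subr_gt0.
have a1 : 0 < (1 - lam) * normal i u by rewrite mulr_gt0.
have a2 : 0 < lam * ((1 - lam) * normal i u) by rewrite mulr_gt0.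
have ll : 0 < lam * (1 - lam) ^+ 2 by rewrite mulr_gt0 ?exprn_gt0.
move: h1 h3; rewrite /descent_form => h1 h3.
case: (vertex_cases i j) => e; subst j.
- lra.
(* For an impact at [i + 1] the first inequality is [h1] itself; the second, times lam, follows from
   [h1] by adding negative terms. *)
- have a4 : lam * (1 - lam) ^+ 2 * normal (i + 1) u < 0 by rewrite pmulr_rlt0.
  apply: descent_cone_impact; rewrite ?vertex_turn ?e2 //; first lra.
  rewrite -(ltr_pM2l lam0); lra.
(* The required forms differ from those of the cone at [i] by (1 - lam)^2 (n_{i+1} - n_i) and (1 -
   lam)^2 (n_{i+3} - n_i). *)
- have [g1 g3] := hop erefl.
  have a4 : 0 <= (1 - lam) ^+ 2 * (normal i u - normal (i + 1) u).
    by rewrite mulr_ge0 ?sqr_ge0 // subr_ge0.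
  have a5 : 0 <= (1 - lam) ^+ 2 * (normal i u - normal (i + 3) u).
    by rewrite mulr_ge0 ?sqr_ge0 // subr_ge0.
  by apply: descent_cone_impact; rewrite ?vertex_turn //; rewrite e2; lra.
- have a4 : lam * (1 - lam) ^+ 2 * normal (i + 3) u < 0 by rewrite pmulr_rlt0.
  apply: descent_cone_impact; rewrite ?vertex_turn ?e2 //; last lra.
  rewrite -(ltr_pM2l lam0); lra.
Qed.

Lemma descent_cone_side i u : descent_cone i u ->
  normal (i + 1) u < 0 \/ normal (i + 3) u < 0.
Proof.
move=> [h0 + _]; rewrite /descent_form.
have a0 : 0 < (1 - lam) * normal i u by rewrite mulr_gt0 // subr_gt0 lam_lt1.
have [h1|h1] := ltP (normal (i + 1) u) 0; [by left|].
have [h3|h3] := ltP (normal (i + 3) u) 0; [by right|].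
have a1 : 0 <= lam ^+ 2 * normal (i + 1) u by rewrite mulr_ge0 // sqr_ge0.
have a3 : 0 <= lam * normal (i + 3) u by rewrite mulr_ge0 // ltW.
by lra.
Qed.

Lemma descent_cone_not_admissible i u : descent_cone i u -> ~ admissible u.
Proof.
by move=> /descent_cone_side[] h /(_ _); [move/(_ (i + 1))|move/(_ (i + 3))];
  rewrite leNgt h.
Qed.

(** In the sum of the two forms the neighbours enter only through n_{i+1} + n_{i+3}, which is twice
    the heave. *)
Lemma descent_cone_heave_lt0 i u : descent_cone i u -> heave u < 0.
Proof.
move=> [h0]; rewrite /descent_form => h1 h3.
have a0 : 0 < (1 - lam) * normal i u by rewrite mulr_gt0 // subr_gt0 lam_lt1.
have s := normal_opposite i u; have s' := normal_sides i u.
rewrite -(pmulr_rlt0 _ (_ : 0 < 2 * (lam ^+ 2 + lam))); last first.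
  by rewrite mulr_gt0 // addr_gt0 // exprn_gt0.
have -> : 2 * (lam ^+ 2 + lam) * heave u =
    (lam ^+ 2 + lam) * (normal (i + 1) u + normal (i + 3) u).
  by rewrite -s' s; ring.
by lra.
Qed.

(** The cone inequalities bound n_i, n_{i+1} and n_{i+3} above; opposite vertices sum to twice the
    heave, which gives the other bounds. *)
Lemma descent_cone_normal_bound i j u : descent_cone i u ->
  `|normal j u| <= 5 / (1 - lam) * - heave u.
Proof.
move=> hc; have v0 := descent_cone_heave_lt0 hc; move: hc => [h0].
rewrite /descent_form => h1 h3.
have l1 := lam_lt1; have ol : 0 < 1 - lam by rewrite subr_gt0.
have s := normal_opposite i u; have s' := normal_sides i u.
rewrite mulrAC ler_pdivlMr // -[X in _ * X](gtr0_norm ol) -normrM ler_norml.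
have e2 : normal (i + 2) u = 2 * heave u - normal i u by lra.
have e3 : normal (i + 3) u = 2 * heave u - normal (i + 1) u by lra.
have b0 : 0 < normal i u * (1 - lam) by rewrite mulr_gt0.
have b1 : 0 < lam * - heave u by rewrite mulr_gt0 // oppr_gt0.
have b2 : 0 < lam * (lam * - heave u) by rewrite mulr_gt0.
have b3 : 0 < (1 - lam) * - heave u by rewrite mulr_gt0 // oppr_gt0.
have b4 : 0 < (1 - lam) * (lam * - heave u) by rewrite mulr_gt0.
have c0 : normal i u * (1 - lam) < 2 * - heave u.
  by move: h1 h3; rewrite e3; lra.
have c1 : normal (i + 1) u * (1 - lam) < 2 * - heave u.
  rewrite -(ltr_pM2l lam0); move: h3; rewrite e3; lra.
have c3 : normal (i + 3) u * (1 - lam) < 2 * - heave u.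
  have e1 : normal (i + 1) u = 2 * heave u - normal (i + 3) u by lra.
  rewrite -(ltr_pM2l lam0); move: h1; rewrite e1; lra.
have sl : (normal (i + 1) u + normal (i + 3) u) * (1 - lam) = 2 * heave u * (1 - lam).
  by congr (_ * _); lra.
apply/andP; case: (vertex_cases i j) => ->; split; rewrite ?e2; lra.
Qed.

(** With [heave_impact], two impacts raise the heave by at least 2 c times its absolute value in
    between. If [j] is opposite to [i], the first impact speed already suffices; otherwise the
    second does. *)
Lemma two_impacts_heave i j l p : 0 < normal i p -> heave p < 0 ->
  normal j p < 0 -> normal l (U j *m p) < 0 ->
  normal j p + normal l (U j *m p) <= 2 * heave (U j *m p).
Proof.
move=> hi v0 hj hl; have c0 := coupling_gt0.
have cj : c * normal j p < 0 by rewrite pmulr_rlt0.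
have jpos : 0 < normal j (U j *m p).
  by rewrite normal_impact_self mulNr oppr_gt0 pmulr_rlt0.
have hv := heave_impact j p.
have [e|jopp] := eqVneq j (i + 2).
  by have := normal_opposite i p; rewrite -e => s; lra.
(* An impact at a neighbour pushes [i] further up, so [l] must be opposite to [i] or to [j]. *)
have ipos : 0 < normal i (U j *m p).
  case: (vertex_cases i j) => e; subst j.
  - lra.
  - have := normal_impact_prev (i + 1) p; rewrite vertex_turn; lra.
  - by rewrite eqxx in jopp.
  - have := normal_impact_next (i + 3) p; rewrite vertex_turn; lra.
have so := normal_opposite j (U j *m p).
have soi := normal_opposite i (U j *m p).
have : [\/ l = j, l = i, l = j + 2 | l = i + 2].
  case: (vertex_cases i j) => ej; subst j; first by exfalso; lra.
  - case: (vertex_cases i l) => ->; rewrite ?vertex_turn;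
      by [apply: Or41|apply: Or42|apply: Or43|apply: Or44].
  - by rewrite eqxx in jopp.
  - case: (vertex_cases i l) => ->; rewrite ?vertex_turn;
      by [apply: Or41|apply: Or42|apply: Or43|apply: Or44].
by case=> e; subst l; lra.
Qed.

(** * Existence of the next impact and of the impact sequence *)

Lemma next_event q p : admissible q -> (exists j, normal j p < 0) ->
  exists i tau, free_flight q p tau /\ impacting i (q + tau *: p) p.
Proof.
(* [F j] is the time at which a descending vertex [j] reaches the plane; the earliest one is the
   event. *)
move=> aq [j0 hj0]; pose F j := normal j q / - normal j p.
have [i hi imin] := @arg_minP _ _ _ j0 (fun j => normal j p < 0) F hj0.
exists i, (F i); split; last first.
  by split=> //; rewrite normalD normalZ /F; field; rewrite lt_eqF.
split=> [|s /andP[s0 sF] j].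
  by rewrite divr_ge0 ?aq // oppr_ge0 ltW.
rewrite normalD normalZ; have [hj|hj] := ltP (normal j p) 0; last first.
  by rewrite addr_ge0 ?aq // mulr_ge0.
have : s <= F j by rewrite (le_trans sF) // imin.
by rewrite /F ler_pdivlMr ?oppr_gt0 // mulrN lerNl -subr_ge0 opprK addrC.
Qed.

Lemma next_impact_exists q p : admissible q -> (exists j, normal j p < 0) ->
  ~ next_impact_simultaneous q p -> exists i tau, next_impact q p i tau.
Proof.
move=> aq hp ns; have [i [tau [hf hi]]] := next_event aq hp.
exists i, tau; split=> // j hj; apply/eqP; rewrite eq_sym; apply: contrapT.
by move=> /negP ij; apply: ns; exists tau, i, j.
Qed.

Lemma impact_sequence_exists q0 p0 :
  (forall q p, reachable m rho gamma q0 p0 q p ->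
     exists i tau, next_impact q p i tau) ->
  exists hit t (qs ps : nat -> 'cV[R]_3),
    infinite_impact_sequence m rho gamma q0 p0 hit t qs ps.
Proof.
move=> ex.
have /choice[f fP] (x : 'cV[R]_3 * 'cV[R]_3) : exists y : 'I_4 * R,
    reachable m rho gamma q0 p0 x.1 x.2 -> next_impact x.1 x.2 y.1 y.2.
  have [r|nr] := pselect (reachable m rho gamma q0 p0 x.1 x.2).
    by have [i [tau h]] := ex _ _ r; exists (i, tau).
  (* A dummy value for unreachable states, which the iteration never visits. *)
  by exists (0, 0).
pose st n := iter n (fun x : 'cV[R]_3 * 'cV[R]_3 =>
  (x.1 + (f x).2 *: x.2, U (f x).1 *m x.2)) (q0, p0).
have rst n : reachable m rho gamma q0 p0 (st n).1 (st n).2.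
  elim: n => [|n IH]; first exact: reachable_init.
  exact: reachable_impact IH (fP _ IH).
exists (fun n => (f (st n)).1), (fun n => \sum_(k < n) (f (st k)).2).
exists (fun n => (st n).1), (fun n => (st n).2); split=> //.
  by rewrite big_ord0.
by move=> k; rewrite big_ord_recr /= addrAC subrr add0r; split=> //; exact: fP.
Qed.

(** * Descending states and their persistence *)

(* The extrapolation [q + s *: p] of the current flight is left alone by free
   motion, and an impact at [i] acts on it by [U i] because [U i] fixes the
   configurations touching the plane at [i]: it can be confined to the same
   cones as the velocity, and its leaving the admissible region bounds the
   remaining time by [s]. *)
Definition descending (s : R) q p : Prop :=
  [/\ admissible q, 0 < s &
      (forall j, normal j p < 0 /\ normal j (q + s *: p) < 0) \/
      exists i, [/\ normal i q = 0, descent_cone i p &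
                    descent_cone i (q + s *: p)]].

(** When [i + 2] touches the plane, h_i = h_{i+1} + h_{i+3} with nonnegative terms, so h_j <= h_i.
    As h_i started at 0 <= h_j, vertex [j] cannot have moved up faster than [i]. *)
Lemma opposite_impact_order i q p tau : admissible q -> normal i q = 0 ->
  descent_cone i p -> next_impact q p (i + 2) tau -> forall j, j = i + 1 \/ j = i + 3 ->
  normal j p <= normal i p /\ normal j (q + tau *: p) <= normal i (q + tau *: p).
Proof.
move=> aq qi hc [[t0 hf] [hz hn] uni].
have aq' : admissible (q + tau *: p) by apply: hf; rewrite t0 lexx.
have s := normal_sides i (q + tau *: p).
have h1 := aq' (i + 1); have h3 := aq' (i + 3).
(* At [tau = 0] all four vertices would touch the plane, and a descending neighbour would be a
   second impacting vertex. *)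
have tp : 0 < tau.
  rewrite lt_neqAle t0 andbT; apply/eqP => tau0.
  have z : normal i (q + tau *: p) = 0 by rewrite -tau0 scale0r addr0.
  have [h|h] := descent_cone_side hc.
  - have /uni/(congr1 val) : impacting (i + 1) (q + tau *: p) p by split=> //; lra.
    by case: (i) => [[|[|[|[|//]]]] hi].
  - have /uni/(congr1 val) : impacting (i + 3) (q + tau *: p) p by split=> //; lra.
    by case: (i) => [[|[|[|[|//]]]] hi].
move=> j hj.
have le : normal j (q + tau *: p) <= normal i (q + tau *: p) by case: hj => ->; lra.
split=> //; rewrite -(ler_pM2l tp).
by move: le (aq j); rewrite !normalD !normalZ qi; lra.
Qed.

Lemma descending_impact s q p i tau : descending s q p -> next_impact q p i tau ->
  [/\ tau < s, descent_cone i (U i *m p) &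
      descending (s - tau) (q + tau *: p) (U i *m p)].
Proof.
move=> [aq s0 hd] ni; have [[t0 hf] [hz hn] _] := ni.
have aq' : admissible (q + tau *: p) by apply: hf; rewrite t0 lexx.
have ts : tau < s.
  rewrite ltNge; apply/negP => st.
  have aQ : admissible (q + s *: p) by apply: hf; rewrite (ltW s0).
  case: hd => [/(_ 0)[_]|[k [_ _ hc]]]; first by rewrite ltNge aQ.
  exact: descent_cone_not_admissible hc aQ.
have eQ : q + s *: p = q + tau *: p + (s - tau) *: p.
  by rewrite -addrA -scalerDl [tau + _]addrC subrK.
have UQ : q + tau *: p + (s - tau) *: (U i *m p) = U i *m (q + s *: p).
  by rewrite eQ [RHS]mulmxDr (impact_fixed hz) -scalemxAr.
have nQ : normal i (q + s *: p) < 0.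
  by rewrite eQ normalD hz add0r normalZ pmulr_rlt0 ?subr_gt0.
have [hp hQ] : descent_cone i (U i *m p) /\ descent_cone i (U i *m (q + s *: p)).
  case: hd => [h|[k [qk hc hC]]].
    by split; apply: descent_cone_first => j; have [] := h j.
  split; apply: descent_cone_step; eauto => e; rewrite {}e in ni.
    by split; apply: (proj1 (opposite_impact_order aq qk hc ni _)); [left|right].
  (* The extrapolated point is the touching configuration plus a positive multiple of [p], and the
     order holds for both. *)
  have lQ j : j = k + 1 \/ j = k + 3 -> normal j (q + s *: p) <= normal k (q + s *: p).
    move=> hj; have [l1 l2] := opposite_impact_order aq qk hc ni hj.
    rewrite eQ !(normalD _ _ ((s - tau) *: p)) !normalZ lerD // ler_wpM2l //.
    by rewrite subr_ge0 ltW.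
  by split; apply: lQ; [left|right].
split=> //; split=> //; first by rewrite subr_gt0.
right; exists i; rewrite UQ; split=> //.
Qed.

Lemma descending_init q p : admissible q -> (forall j, normal j p < 0) ->
  exists s, descending s q p.
Proof.
(* The sum dominates each vertex's time to reach the plane, and the 1 makes this strict. *)
move=> aq hp; pose s := 1 + \sum_j normal j q / - normal j p.
have d0 j : 0 <= normal j q / - normal j p by rewrite divr_ge0 ?aq // oppr_ge0 ltW.
exists s; split=> //; first by rewrite ltr_pwDl // sumr_ge0.
left=> j; split=> //; rewrite normalD normalZ -ltrBrDl sub0r.
rewrite -(ltr_nM2r (_ : (- normal j p)^-1 * -1 < 0)); last first.
  by rewrite mulrN1 oppr_lt0 invr_gt0 oppr_gt0.
have pn : normal j p != 0 by rewrite lt_eqF.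
rewrite [X in _ < X](_ : _ = s); last by field.
rewrite [X in X < _](_ : _ = normal j q / - normal j p); last by field.
by rewrite /s (bigD1 j) //= ltr_pwDl // lerDl sumr_ge0.
Qed.

Lemma descending_moves_down s q p : descending s q p -> exists j, normal j p < 0.
Proof.
move=> [_ _ [h|[i [_ /descent_cone_side hc _]]]]; first by exists 0; have [] := h 0.
by case: hc => h; eexists; exact: h.
Qed.

Lemma descending_reachable q0 p0 q p s : descending s q0 p0 ->
  reachable m rho gamma q0 p0 q p -> exists s', descending s' q p.
Proof.
move=> h0; elim=> [|{}q {}p i tau _ [s' h] ni]; first by exists s.
by have [_ _ ?] := descending_impact h ni; exists (s' - tau).
Qed.

(** Each coordinate is half the sum or difference of the normal components at two opposite
    vertices. *)
Lemma mx_norm_le_normal (C : R) u : (forall j, `|normal j u| <= C) -> `|u| <= C.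
Proof.
move=> h; have C0 : 0 <= C := le_trans (normr_ge0 _) (h 0).
rewrite [`|u|]mx_normrE bigmax_le // => -[k l] _ /=; rewrite (ord1 l) ler_norml.
have := h 0; have := h 1; have := h (1 + 1); have := h (1 + 2).
rewrite !normal_coord /vertex_x /vertex_y /= !ler_norml.
move=> /andP[a b] /andP[c' d] /andP[e f] /andP[g g']; apply/andP.
have [->|k0] := eqVneq k 0; first by split; lra.
have [->|k1] := eqVneq k 1; first by split; lra.
have -> : k = ord_max by case: k k0 k1 => [[|[|[|//]]] hk] // _ _; apply: val_inj.
by rewrite -/(heave u); split; lra.
Qed.

(** * Limits of the impact times and velocities *)

Section Sequence.
Variables (q0 p0 : 'cV[R]_3) (hit : nat -> 'I_4) (t : nat -> R)
  (q p : nat -> 'cV[R]_3) (T : R).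
Hypothesis seqP : infinite_impact_sequence m rho gamma q0 p0 hit t q p.
Hypothesis desc0 : descending T q0 p0.

Lemma sequence_descending k : descending (T - t k) (q k) (p k).
Proof.
have [t0 eq0 ep0 step] := seqP.
elim: k => [|k IH]; first by rewrite t0 subr0 eq0 ep0.
have [ni -> ->] := step k; have [_ _] := descending_impact IH ni.
by rewrite opprB addrA subrK.
Qed.

Lemma sequence_cone k : descent_cone (hit k) (p k.+1).
Proof.
have [_ _ _ step] := seqP; have [ni _ ->] := step k.
by have [] := descending_impact (sequence_descending k) ni.
Qed.

Lemma sequence_time_cvg : exists T' : R, (t k @[k --> \oo] --> T')%classic.
Proof.
have [_ _ _ step] := seqP; exists (limn t).
apply: nondecreasing_is_cvgn.
  apply/nondecreasing_seqP => k; have [[[h _] _ _] _ _] := step k.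
  by rewrite -subr_ge0.
exists T => _ [k _ <-]; have [_ + _] := sequence_descending k.
by rewrite subr_gt0 => /ltW.
Qed.

(** The heave increases and stays negative; its limit L satisfies -2 c L <= L - L = 0 by the
    two-impact estimate, hence L = 0. *)
Lemma sequence_heave_cvg0 : (heave (p k.+1) @[k --> \oo] --> (0 : R))%classic.
Proof.
have [_ _ _ step] := seqP; have c0 := coupling_gt0.
(* The index starts after the first impact, because the cones concern velocities just after an
   impact. *)
pose V k := heave (p k.+1).
have hitV k : normal (hit k.+1) (p k.+1) < 0 by have [[_ [_]]] := step k.+1.
have V0 k : V k < 0 := descent_cone_heave_lt0 (sequence_cone k).
have VS k : V k.+1 = V k - c * normal (hit k.+1) (p k.+1).
  by have [_ _ e] := step k.+1; rewrite /V e heave_impact.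
have Vinc : nondecreasing_seq V.
  apply/nondecreasing_seqP => k; rewrite VS lerDl oppr_ge0.
  by rewrite pmulr_rle0 // ltW.
have Vcvg : cvgn V.
  apply: nondecreasing_is_cvgn => //; exists 0 => _ [k _ <-]; exact: ltW.
have V2 k : - (2 * c) * V k.+1 <= V k.+2 - V k.
  have e1 := VS k; have e2 := VS k.+1.
  have [h0 _ _] := sequence_cone k; have [_ _ e] := step k.+1.
  have := two_impacts_heave h0 (V0 k) (hitV k); rewrite -e => /(_ _ (hitV k.+1)).
  rewrite -/(V k.+1) -(ler_pM2l c0); lra.
have V1l : (V k.+1 @[k --> \oo] --> limn V)%classic by rewrite cvg_shiftS.
have V2l : (V k.+2 @[k --> \oo] --> limn V)%classic.
  by rewrite (cvg_shiftS (fun k => V k.+1)).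
have L0 : limn V <= 0 by apply: limr_le => //; apply: nearW => k; exact: ltW.
have : - (2 * c) * limn V <= limn V - limn V.
  have A : (- (2 * c) * V k.+1 @[k --> \oo] --> - (2 * c) * limn V)%classic.
    exact: cvgM (cvg_cst _) V1l.
  have B : (V k.+2 - V k @[k --> \oo] --> limn V - limn V)%classic.
    exact: cvgB V2l Vcvg.
  by apply: (ler_cvg_to A B); apply: nearW; exact: V2.
have c20 : 0 < 2 * c by rewrite mulr_gt0.
rewrite subrr mulNr oppr_le0 pmulr_rge0 // => L1.
have -> : (0 : R) = limn V by apply/eqP; rewrite eq_le L0 L1.
exact: Vcvg.
Qed.

Lemma sequence_velocity_cvg0 : (p k @[k --> \oo] --> (0 : 'cV[R]_3))%classic.
Proof.
rewrite -cvg_shiftS; apply/norm_cvg0P.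
have B k : 0 <= `|p k.+1| <= 5 / (1 - lam) * - heave (p k.+1).
  rewrite normr_ge0 /=; apply: mx_norm_le_normal => j.
  exact: descent_cone_normal_bound (sequence_cone k).
have A : (5 / (1 - lam) * - heave (p k.+1) @[k --> \oo] --> (0 : R))%classic.
  have -> : (0 : R) = 5 / (1 - lam) * - 0 by rewrite oppr0 mulr0.
  by apply: cvgM; [exact: cvg_cst | apply: cvgN; exact: sequence_heave_cvg0].
have Z : ((0 : R) @[k --> \oo] --> (0 : R))%classic by exact: cvg_cst.
apply: (squeeze_cvgr _ Z A); apply: nearW; exact: B.
Qed.

End Sequence.

(** * Assembly of the chatter motion *)

Lemma chatter q0 p0 : admissible q0 -> (forall j, normal j p0 < 0) ->
  no_simultaneous_impacts m rho gamma q0 p0 ->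
  complete_chatter m rho gamma q0 p0.
Proof.
move=> aq hp hs; have [T dT] := descending_init aq hp.
have [|hit [t [q [p sP]]]] := @impact_sequence_exists q0 p0.
  move=> q p r; have [s hd] := descending_reachable dT r.
  apply: next_impact_exists (descending_moves_down hd) (hs _ _ r).
  by have [] := hd.
exists hit, t, q, p; split=> //; first exact: sequence_time_cvg sP dT.
exact: sequence_velocity_cvg0 sP dT.
Qed.

End Cone.

Theorem theorem6 (R : realType) (m rho gamma : R) (q0 p0 : 'cV[R]_3)
  (m_gt0 : 0 < m) (rho_gt0 : 0 < rho)
  (gamma_gt0 : 0 < gamma) (gamma_lt1 : gamma < 1)
  (hdom : dominant_eigenvalue_real_positive
            (impact_mx m rho gamma ord0 *m rot_mx (pi / 2)))
  (hq0 : admissible q0)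
  (hp0 : forall i : 'I_4, normal i p0 < 0)
  (hsingle : no_simultaneous_impacts m rho gamma q0 p0) :
  complete_chatter m rho gamma q0 p0.
Proof.
(* [eigenvalue_map] brings the eigenvalue back from [R[i]] to the real matrix. *)
have [lam lam0 [+ _]] := hdom; rewrite eigenvalue_map => hlam.
exact: (chatter m_gt0 rho_gt0 gamma_gt0 lam0
  (eigenvalue_cubic m_gt0 rho_gt0 hlam) gamma_lt1 hq0 hp0 hsingle).
Qed.
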